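(* Let $G$ be a graph with $n$ vertices. Then for every $k \in \mathbb{N}$, $$\frac{P_{DP}(G,k+1)}{(k+1)^n} \geq \frac{P_{DP}(G,k)}{k^n}.$$
   Context: All graphs are finite, simple, and nonempty (at least one vertex). $\mathbb{N}$ denotes the set of positive integers. For a graph $H$ and $S_1,S_2 \subseteq V(H)$, $E_H(S_1,S_2)$ is the set of edges of $H$ with one endpoint in $S_1$ and the other in $S_2$. A (DP-)cover of a graph $G$ is a pair $\mathcal{H} = (L,H)$, where $H$ is a graph and $L: V(G) \to 2^{V(H)}$ is a function such that: (1) $\{L(v) : v \in V(G)\}$ is a partition of $V(H)$ of size $|V(G)|$; (2) for every $v \in V(G)$, the induced subgraph $H[L(v)]$ is complete; (3) if $E_H(L(u),L(v))$ is nonempty, then $u=v$ or $uv \in E(G)$; (4) if $uv \in E(G)$, then $E_H(L(u),L(v))$ is a (possibly empty) matching. The cover is $k$-fold if $|L(v)| = k$ for every $v \in V(G)$. An $\mathcal{H}$-coloring of $G$ is an independent set in $H$ of size $|V(G)|$; $P_{DP}(G,\mathcal{H})$ denotes the number of $\mathcal{H}$-colorings of $G$. The DP color function $P_{DP}(G,k)$ is the minimum of $P_{DP}(G,\mathcal{H})$ over all $k$-fold covers $\mathcal{H}$ of $G$. *)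

(* Defs.v *)
From mathcomp Require Import all_boot.
From mathcomp Require Import boolp.

Set Implicit Arguments.
Unset Strict Implicit.
Unset Printing Implicit Defensive.

Record sgraph := SGraph {
  vertex :> finType;
  adj : rel vertex;
  adj_sym : symmetric adj;
  adj_irr : irreflexive adj;
  vertex_gt0 : 0 < #|vertex| }.

(* An edge is represented by the two-element set of its endpoints. *)
Definition edges_between (H : sgraph) (S1 S2 : {set H}) : {set {set H}} :=
  [set [set x; y] | x in S1, y in S2 & adj x y].

(* A matching is a set of pairwise disjoint edges; the empty set is one. *)
Definition matching (H : sgraph) (M : {set {set H}}) : bool := trivIset M.

Definition complete_on (H : sgraph) (S : {set H}) : Prop :=
  {in S &, forall x y, x != y -> adj x y}.

Definition independent (H : sgraph) (I : {set H}) : bool :=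
  [forall x in I, forall y in I, ~~ adj x y].

Record DP_cover (G : sgraph) := DPCover {
  cover_graph : sgraph;
  cover_list : G -> {set cover_graph};
  cover_partition : partition [set cover_list v | v : G] [set: cover_graph];
  cover_size : #|[set cover_list v | v : G]| = #|G|;
  cover_complete : forall v : G, complete_on (cover_list v);
  cover_edges : forall u v : G,
    edges_between (cover_list u) (cover_list v) != set0 -> u = v \/ adj u v;
  cover_matching : forall u v : G,
    adj u v -> matching (edges_between (cover_list u) (cover_list v)) }.

Definition kfold (G : sgraph) (k : nat) (C : DP_cover G) : Prop :=
  forall v : G, #|cover_list C v| = k.

Definition colorings (G : sgraph) (C : DP_cover G) :
    {set {set cover_graph C}} :=
  [set I : {set cover_graph C} | independent I & #|I| == #|G|].

Definition P_DP_cover (G : sgraph) (C : DP_cover G) : nat := #|colorings C|.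

Definition cover_count (G : sgraph) (k m : nat) : Prop :=
  exists2 C : DP_cover G, kfold k C & P_DP_cover C = m.

(* The minimum of P_DP_cover over all k-fold covers. Such covers exist for
   every k > 0 (lemma P_DPP below); the value 0 of the else branch is only
   taken when k = 0, where the blocks of the partition would be empty. *)
Definition P_DP (G : sgraph) (k : nat) : nat :=
  if pselect (exists m, `[< cover_count G k m >]) is left ex
  then ex_minn ex else 0.

Section EdgelessCover.
Variables (G : sgraph) (k : nat).
Hypothesis k_gt0 : 0 < k.

Let W : finType := (G * 'I_k)%type.
Let h : rel W := fun x y => (x.1 == y.1) && (x != y).

Fact fibre_sym : symmetric h.
Proof. by move=> x y; rewrite /h eq_sym [x == y]eq_sym. Qed.

Fact fibre_irr : irreflexive h.
Proof. by move=> x; rewrite /h !eqxx. Qed.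

Fact fibre_gt0 : 0 < #|W|.
Proof. by rewrite card_prod card_ord muln_gt0 vertex_gt0. Qed.

Let HG : sgraph := SGraph fibre_sym fibre_irr fibre_gt0.
Let L (v : G) : {set HG} := [set x : W | x.1 == v].

Lemma fibre_inj : injective L.
Proof.
move=> u v /setP/(_ (u, Ordinal k_gt0)); rewrite !inE /= eqxx.
by move/esym/eqP.
Qed.

Lemma fibre_partition : partition [set L v | v : G] [set: HG].
Proof.
apply/and3P; split.
- apply/eqP/setP=> x; rewrite inE; apply/bigcupP; exists (L x.1).
    exact: imset_f.
  by rewrite inE.
- apply/trivIsetP=> _ _ /imsetP[u _ ->] /imsetP[v _ ->] Luv.
  rewrite -setI_eq0; apply/eqP/setP=> x; rewrite !inE.
  apply/negP=> /andP[/eqP xu /eqP xv].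
  by rewrite -xu -xv eqxx in Luv.
- apply/imsetP=> -[v _ /setP/(_ (v, Ordinal k_gt0))].
  by rewrite !inE /= eqxx.
Qed.

Lemma fibre_complete v : complete_on (L v).
Proof.
move=> x y; rewrite !inE => /eqP xv /eqP yv nxy.
by rewrite /= /h xv yv eqxx.
Qed.

Lemma fibre_edges u v : edges_between (L u) (L v) != set0 -> u = v.
Proof.
case/set0Pn=> E /imset2P[x y]; rewrite !inE => /eqP xu /andP[/eqP yv hxy] _.
by rewrite -xu -yv; case/andP: hxy => /eqP.
Qed.

Lemma fibre_matching u v : adj u v -> matching (edges_between (L u) (L v)).
Proof.
have [->|/fibre_edges->] := eqVneq (edges_between (L u) (L v)) set0.
  by move=> _; apply/trivIsetP=> A B; rewrite inE.
by rewrite adj_irr.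
Qed.

Definition edgeless_cover : DP_cover G :=
  DPCover fibre_partition (card_imset _ fibre_inj) fibre_complete
    (fun u v E => or_introl (fibre_edges E)) fibre_matching.

Lemma edgeless_cover_kfold : kfold k edgeless_cover.
Proof.
move=> v; rewrite /= /L.
have -> : [set x : W | x.1 == v] = setX [set v] [set: 'I_k].
  by apply/setP=> x; rewrite !inE andbT.
by rewrite cardsX cards1 cardsT card_ord mul1n.
Qed.

End EdgelessCover.

Lemma P_DPP (G : sgraph) (k : nat) : 0 < k ->
  cover_count G k (P_DP G k) /\
  forall C : DP_cover G, kfold k C -> P_DP G k <= P_DP_cover C.
Proof.
move=> k_gt0; rewrite /P_DP; case: pselect => [ex|[]]; last first.
  exists (P_DP_cover (edgeless_cover G k_gt0)); apply/asboolP.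
  by exists (edgeless_cover G k_gt0) => //; apply: edgeless_cover_kfold.
case: ex_minnP => m /asboolP mC minm; split=> // C kC.
by apply: minm; apply/asboolP; exists C.
Qed.

(* Main.v *)
Require Import Defs.
From mathcomp Require Import all_boot all_order all_algebra.
Import Order.TTheory GRing.Theory Num.Theory.
Local Open Scope ring_scope.

(** Take a [(k+1)]-fold cover [C] attaining [P_DP G (k + 1)] and delete one
    vertex from every list. Whatever the deletion, what remains is a [k]-fold
    cover, whose colorings are the colorings of [C] that avoid the deleted
    vertices; hence at least [P_DP G k] colorings survive. On the other hand a
    coloring of [C] meets every list in exactly one vertex, so among the
    [(k+1)^n] deletions it survives precisely those that remove, from each
    list, one of the [k] other vertices: there are [k^n] of them. Counting the
    pairs (deletion, surviving coloring) in both orders gives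
      [(k+1)^n * P_DP G k <= k^n * P_DP G (k + 1)],
    which is the claim. The surviving cover is built in [restrict_cover], the
    two counts are [P_DP_avoiding] and [card_sparing_transversals], and they
    are combined in [P_DP_double_count]. *)

Section CoverLists.
Set Implicit Arguments.
Unset Strict Implicit.
Variables (G : sgraph) (C : DP_cover G).

Lemma cover_list_exists (x : cover_graph C) : exists v : G, x \in cover_list C v.
Proof.
have /and3P[/eqP covC _ _] := Defs.cover_partition C.
have: x \in cover [set cover_list C v | v : G] by rewrite covC inE.
by case/bigcupP=> _ /imsetP[v _ ->]; exists v.
Qed.

(** The lists are indexed without repetition because there are [#|G|] of
    them, and distinct blocks of a partition are disjoint. *)
Lemma cover_list_uniq (u v : G) (x : cover_graph C) :
  x \in cover_list C u -> x \in cover_list C v -> u = v.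
Proof.
have /and3P[_ /trivIsetP trivC _] := Defs.cover_partition C.
have injL : injective (cover_list C).
  by have /imset_injP injL := introT eqP (cover_size C) => a b; apply: injL.
move=> xu xv; apply: contraTeq xv => neq_uv.
have := trivC _ _ (imset_f _ (isT : u \in G)) (imset_f _ (isT : v \in G)).
by rewrite (inj_eq injL) => /(_ neq_uv)/disjointFr->.
Qed.

(** Each list is a clique, so an independent set has at most one vertex in it;
    having as many vertices as there are lists, it misses none of them. *)
Lemma coloring_meets_lists (I : {set cover_graph C}) (v : G) :
  I \in colorings C -> exists2 x, x \in I & x \in cover_list C v.
Proof.
rewrite inE => /andP[/forall_inP indI /eqP cardI].
have [c cP] : {c : cover_graph C -> G | forall x, x \in cover_list C (c x)}.
  exists (fun x => xchoose (cover_list_exists x)) => x.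
  exact: (xchooseP (cover_list_exists x)).
have inj_c : {in I &, injective c}.
  move=> x y xI yI eq_c; have /forall_inP/(_ y yI) := indI x xI.
  apply: contraNeq; apply: cover_complete (cP x) _.
  by rewrite eq_c; apply: cP.
have /setP/(_ v) : c @: I = setT.
  apply/eqP; rewrite eqEcard subsetT cardsT (card_in_imset inj_c) cardI.
  exact: leqnn.
by rewrite inE => /imsetP[x xI ->]; exists x.
Qed.

End CoverLists.

(** A set of vertices that meets every list induces a cover again; meeting
    every list is what keeps the blocks of the partition nonempty and
    pairwise distinct. *)
Section RestrictCover.
Set Implicit Arguments.
Unset Strict Implicit.
Variables (G : sgraph) (C : DP_cover G) (S : {set cover_graph C}).
Hypothesis meetS : forall v : G, exists2 x, x \in S & x \in cover_list C v.

Let T : finType := {x : cover_graph C | x \in S}.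
Let radj : rel T := relpre val (@adj (cover_graph C)).

Fact radj_sym : symmetric radj.
Proof. by move=> x y; apply: adj_sym. Qed.

Fact radj_irr : irreflexive radj.
Proof. by move=> x; apply: adj_irr. Qed.

Fact radj_gt0 : (0 < #|T|)%N.
Proof.
have /card_gt0P[v _] := vertex_gt0 G.
by have [x xS _] := meetS v; apply/card_gt0P; exists (exist _ x xS).
Qed.

Let RG : sgraph := SGraph radj_sym radj_irr radj_gt0.
Let L (v : G) : {set RG} := [set x : T | val x \in cover_list C v].

Fact restrict_list_inj : injective L.
Proof.
move=> u v eqL; have [x xS xu] := meetS u.
have /setP/(_ (exist _ x xS)) := eqL.
by rewrite !inE /= xu => /esym; apply: cover_list_uniq.
Qed.

Fact restrict_partition : partition [set L v | v : G] [set: RG].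
Proof.
apply/and3P; split.
- apply/eqP/setP=> x; rewrite inE; apply/bigcupP.
  have [v xv] := cover_list_exists (val x).
  by exists (L v); [apply: imset_f | rewrite inE].
- apply/trivIsetP=> _ _ /imsetP[u _ ->] /imsetP[v _ ->] Luv.
  rewrite -setI_eq0; apply/eqP/setP=> x; rewrite !inE.
  apply/negP=> /andP[xu xv].
  by rewrite (cover_list_uniq xu xv) eqxx in Luv.
- apply/imsetP=> -[v _ /setP L0]; have [x xS xv] := meetS v.
  by have := L0 (exist _ x xS); rewrite !inE /= xv.
Qed.

Fact restrict_complete (v : G) : complete_on (L v).
Proof. by move=> x y; rewrite !inE => xv yv neq_xy; apply: cover_complete xv yv _. Qed.

Fact restrict_edge (u v : G) (E : {set RG}) :
  E \in edges_between (L u) (L v) ->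
  val @: E \in edges_between (cover_list C u) (cover_list C v).
Proof.
case/imset2P=> x y; rewrite !inE => xu /andP[yv xy] ->.
rewrite imsetU !imset_set1; apply/imset2P.
by exists (val x) (val y); rewrite ?inE ?yv.
Qed.

Fact restrict_edges (u v : G) :
  edges_between (L u) (L v) != set0 -> u = v \/ adj u v.
Proof.
case/set0Pn=> E /restrict_edge EC; apply: (cover_edges (d := C)).
by apply/set0Pn; exists (val @: E).
Qed.

Fact restrict_matching (u v : G) :
  adj u v -> matching (edges_between (L u) (L v)).
Proof.
move=> uv; have /trivIsetP matC := cover_matching C uv; apply/trivIsetP=> A B AE BE neqAB.
have := matC _ _ (restrict_edge AE) (restrict_edge BE).
rewrite (inj_eq (imset_inj val_inj)) => /(_ neqAB).
by rewrite (imset_disjoint val_inj).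
Qed.

Definition restrict_cover : DP_cover G :=
  DPCover restrict_partition (card_imset _ restrict_list_inj)
    restrict_complete restrict_edges restrict_matching.

Lemma card_restrict_list (v : G) :
  #|cover_list restrict_cover v| = #|cover_list C v :&: S|.
Proof.
rewrite -(card_imset _ (val_inj : injective (val : T -> _))).
apply: eq_card => x; rewrite inE; apply/imsetP/andP.
  by case=> y; rewrite inE => yv ->; split=> //; apply: (valP y).
by case=> xv xS; exists (exist _ x xS); rewrite ?inE.
Qed.

Lemma P_DP_restrict_cover :
  (P_DP_cover restrict_cover <= #|[set I in colorings C | I \subset S]|)%N.
Proof.
rewrite /P_DP_cover -(card_imset _ (imset_inj (val_inj : injective (val : T -> _)))).
apply/subset_leq_card/subsetP=> _ /imsetP[I + ->].
rewrite !inE => /andP[/forall_inP indI cardI].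
rewrite (card_imset _ val_inj) cardI andbT; apply/andP; split.
  apply/forall_inP=> _ /imsetP[x xI ->]; apply/forall_inP=> _ /imsetP[y yI ->].
  by have /forall_inP/(_ y yI) := indI x xI.
by apply/subsetP=> _ /imsetP[x _ ->]; apply: (valP x).
Qed.

End RestrictCover.

Section DoubleCount.
Set Implicit Arguments.
Unset Strict Implicit.
Variables (G : sgraph) (k : nat) (C : DP_cover G).
Hypotheses (k_gt0 : (0 < k)%N) (kC : kfold k.+1 C).

Definition transversals := family (fun v : G => mem (cover_list C v)).

Definition sparing (I : {set cover_graph C}) (f : {ffun G -> cover_graph C}) :=
  [forall v, f v \notin I].

Lemma card_transversals : #|transversals| = (k.+1 ^ #|G|)%N.
Proof.
rewrite card_family foldrE big_map big_enum /=.
by under eq_bigr do rewrite kC; rewrite prod_nat_const.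
Qed.

(** Disjointness of the lists makes the transversal [f] cost each list exactly
    one vertex, so the complement of its image induces a [k]-fold cover. *)
Lemma P_DP_avoiding (f : {ffun G -> cover_graph C}) : f \in transversals ->
  (P_DP G k <= #|[set I in colorings C | sparing I f]|)%N.
Proof.
move=> /familyP fL; pose S := ~: [set f v | v : G].
have LS v : cover_list C v :&: S = cover_list C v :\ f v.
  apply/setP=> x; rewrite !inE andbC.
  have [xv|] := boolP (x \in cover_list C v); last by rewrite !andbF.
  rewrite !andbT; congr (~~ _); apply/imsetP/eqP=> [[u _ def_x]|->]; last by exists v.
  by rewrite def_x (cover_list_uniq (fL u) (_ : f u \in cover_list C v)) -?def_x.
have cardLS v : #|cover_list C v :&: S| = k.
  by apply: succn_inj; rewrite LS -(kC v) (cardsD1 (f v) (cover_list C v)) fL.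
have meetS v : exists2 x, x \in S & x \in cover_list C v.
  have /card_gt0P[x] : (0 < #|cover_list C v :&: S|)%N by rewrite cardLS.
  by rewrite inE => /andP[xv xS]; exists x.
have [_ minP] := P_DPP G k_gt0.
apply: leq_trans (minP (restrict_cover meetS) _) _.
  by move=> v; rewrite card_restrict_list.
apply: leq_trans (P_DP_restrict_cover meetS) _.
apply/subset_leq_card/subsetP=> I; rewrite !inE => /andP[-> /subsetP IS].
apply/forallP=> v; apply/negP=> /IS; rewrite inE => /negP; apply.
exact: imset_f.
Qed.

(** A transversal sparing [I] chooses within [cover_list C v :\: I], which has
    lost at least one of the [k.+1] vertices of the list. *)
Lemma card_sparing_transversals (I : {set cover_graph C}) : I \in colorings C ->
  (#|[set f in transversals | sparing I f]| <= k ^ #|G|)%N.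
Proof.
move=> IC.
have -> : #|[set f in transversals | sparing I f]| =
          #|family (fun v : G => mem (cover_list C v :\: I))|.
  apply: eq_card => f; rewrite inE; apply/andP/familyP.
    by case=> /familyP fL /forallP fI v; rewrite !inE fI; apply: fL.
  move=> fLI; split; first by apply/familyP=> v; have /setDP[] := fLI v.
  by apply/forallP=> v; have /setDP[] := fLI v.
rewrite card_family foldrE big_map big_enum /= -prod_nat_const.
apply: leq_prod => v _; have [x xI xv] := coloring_meets_lists v IC.
rewrite -ltnS -(kC v); apply/proper_card/properP; split; first exact: subsetDl.
by exists x => //; rewrite inE xI.
Qed.

Lemma P_DP_double_count :
  (P_DP G k * k.+1 ^ #|G| <= P_DP_cover C * k ^ #|G|)%N.
Proof.
rewrite mulnC -card_transversals /P_DP_cover -!sum_nat_const.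
apply: (@leq_trans (\sum_(f in transversals)
                      \sum_(I in colorings C | sparing I f) 1)).
  apply: leq_sum => f /P_DP_avoiding le_f; apply: leq_trans le_f _.
  by rewrite -sum1_card; apply/eq_leq/eq_bigl=> I; rewrite inE.
rewrite (exchange_big_dep (mem (colorings C))) /=; last by move=> f I _ /andP[].
apply: leq_sum => I IC; apply: leq_trans (card_sparing_transversals IC).
by rewrite -sum1_card; apply/eq_leq/eq_bigl=> f; rewrite inE IC.
Qed.

End DoubleCount.

Theorem theorem6 (G : sgraph) (n : nat) (hn : #|G| = n) (k : nat)
    (hk : (0 < k)%N) :
  (P_DP G (k + 1))%:R / (k + 1)%:R ^+ n >= (P_DP G k)%:R / k%:R ^+ n :> rat.
Proof.
rewrite addn1 -hn.
have [[C kC <-] _] := P_DPP G (ltn0Sn k).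
rewrite ler_pdivrMr ?exprn_gt0 ?ltr0n // mulrAC ler_pdivlMr ?exprn_gt0 ?ltr0n //.
by rewrite -!natrX -!natrM ler_nat; apply: (P_DP_double_count hk kC).
Qed.
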